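(* Suppose that the following three assumptions hold: (A1) there is a constant $r_0\in(0,\infty)$ such that $\inf_{r\in(0,r_0]}\underline\pi(r)>0$, and $\inf_{r\in(r_0,s)}\underline\alpha(r)>0$ for any $s\in(r_0,\infty)$; (A2) $\sup_{r\in(0,s)}\overline\beta(r)<\infty$ for any $s\in(0,\infty)$; (A3) $\limsup_{r\to\infty}r^{-1}\overline\beta(r)<0$. Let $\rho(x,y)=f(d(x,y))$, where $f:[0,\infty)\to[0,\infty)$ is the concave increasing function $$f(r)=a\,\mathbf 1_{r>0}+\int_0^r\varphi(s\wedge r_2)\,g(s\wedge r_2)\,ds$$ with $a$, $r_2$, $\varphi$, $g$ as specified in the context. Then for any $x,y\in S$, $$\mathbb{E}_{x,y}[\rho(X',Y')]\le(1-c)\,\rho(x,y),$$ where $c$ is the explicit strictly positive constant $$c=\min\left(\frac12\inf_{r\le r_0}\underline\pi(r),\ \frac14\left(\int_0^{r_2}\frac1{\varphi(s)}\sup_{u\in\hat I_s}\frac{a+\Phi(u)}{\underline\alpha(u)}\,ds\right)^{-1}\right).$$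
   Context: Setting. $(S,d)$ is a separable metric space and $p(x,dy)$ is a Markov transition kernel on $S$. A Markovian coupling of the transition probabilities is given: measurable maps $X',Y':\Omega\to S$ on a measurable space $(\Omega,\mathcal A)$ and a probability kernel $(x,y,A)\mapsto\mathbb{P}_{x,y}(A)$ such that for any $x,y\in S$, $X'\sim p(x,\cdot)$ and $Y'\sim p(y,\cdot)$ under $\mathbb{P}_{x,y}$. Fix $\epsilon>0$. For $x,y\in S$ put $r=d(x,y)$, $R'=d(X',Y')$, $\Delta R=R'-r$, $(\Delta R)^-=\max(-\Delta R,0)$ and $$\beta(x,y)=\mathbb{E}_{x,y}[\Delta R],\quad \alpha(x,y)=\mathbb{E}_{x,y}\big[|(\Delta R)^-\wedge\epsilon|^2\big],\quad \pi(x,y)=\mathbb{P}_{x,y}[R'=0].$$ $\overline\beta:(0,\infty)\to\mathbb{R}$ and $\underline\alpha,\underline\pi:(0,\infty)\to[0,\infty)$ are functions such that for any $r>0$ and $x,y\in S$ with $d(x,y)=r$: $\beta(x,y)\le\overline\beta(r)$, $\alpha(x,y)\ge\underline\alpha(r)$, $\pi(x,y)\ge\underline\pi(r)$. Construction of $f$ (with $r_0$ from (A1)). For $r,s>0$ let $I_r=((r-\epsilon)^+,r)$ and $\hat I_s=\{r>r_0:s\in I_r\}=(s,s+\epsilon)\cap(r_0,\infty)$. For $r>r_0$ let $\overline\gamma(r)=2\overline\beta(r)/\underline\alpha(r)$. Let $\tilde\gamma:[0,\infty)\to[0,\infty)$ be a function satisfying $\sup_{r\in\hat I_s}\overline\gamma(r)\le\tilde\gamma(s)$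 for any $s\in[0,\infty)$ (such a function exists by (A1) and (A2)), chosen, as (A3) allows, such that $r_1:=\sup\{r>0:\tilde\gamma(r)>0\}$ is finite (with $\sup\emptyset=0$). Set $$\varphi(r)=\exp\Big(-\int_0^r\tilde\gamma(s)\,ds\Big),\qquad \Phi(r)=\int_0^r\varphi(s)\,ds.$$ The constant $a\in(0,\infty)$ is chosen such that $$a\ge r_0+2\sup_{d(x,y)\le r_0}\frac{\beta(x,y)}{\pi(x,y)}.$$ The constant $r_2\in(r_1,\infty)$ is chosen such that $$-\frac{\overline\beta(r)}{a+\Phi(r)}\ge\frac12\left(\int_{r_1}^{r_2}\frac{\Phi(s)}{\underline\alpha(s)}\,ds\right)^{-1}\quad\text{for all }r\ge r_2.$$ Finally, with $c$ as defined in the claim, $$g(r)=1-2c\int_0^r\frac1{\varphi(s)}\sup_{u\in\hat I_s}\frac{a+\Phi(u)}{\underline\alpha(u)}\,ds.$$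
   Formalization: For x=y the bound is claimed only if π(x,x)=1, since it fails otherwise; in the condition on r_2 the integral of Φ/α runs over (r_1,r_2)∩(r_0,∞), as the literal claim is false when r_1<r_0 and α is tiny on (0,r_0]; γ̃ is taken locally integrable. *)

(* Defs.v *)
From HB Require Import structures.
From mathcomp Require Import all_boot all_order all_algebra.
From mathcomp Require Import all_classical all_reals all_analysis.

Set Implicit Arguments.
Unset Strict Implicit.
Unset Printing Implicit Defensive.

Import Order.TTheory GRing.Theory Num.Theory.
Import numFieldNormedType.Exports.

Local Open Scope classical_set_scope.
Local Open Scope ring_scope.

(* The library's measurable types are pointed; its metric spaces are not. *)
#[short(type="pmetricType")]
HB.structure Definition PointedMetric (K : numDomainType) :=
  {M of Pointed M & Metric K M}.

Definition separable (T : topologicalType) : Prop :=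
  exists D : set T, countable D /\ dense D.

Definition borel (R : realType) (S : pmetricType R) :=
  g_sigma_algebraType (@open S).

Definition concave_function (R : realType) (D : set R) (f : R -> R) : Prop :=
  convex_function (D : set R^o) (\- f).

Section coupling.
Context (R : realType) (S : pmetricType R).
Context (d : measure_display) (Omega : measurableType d).
Variables (P : R.-pker (borel S * borel S)%type ~> Omega).
Variables (X' Y' : {mfun Omega >-> borel S}).

Definition markovian_coupling (p : R.-pker (borel S) ~> (borel S)) : Prop :=
  forall (x y : S) (A : set (borel S)), measurable A ->
    pushforward (P (x, y)) X' A = p x A /\
    pushforward (P (x, y)) Y' A = p y A.

Definition newdist (w : Omega) : R := mdist (X' w : S) (Y' w : S).

Definition deltaR (x y : S) (w : Omega) : R := newdist w - mdist x y.

(* Since deltaR x y >= - mdist x y, this integral always makes sense, possibly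
   as +oo. *)
Definition beta (x y : S) : \bar R :=
  (\int[P (x, y)]_w (deltaR x y w)%:E)%E.

Definition alpha (eps : R) (x y : S) : \bar R :=
  (\int[P (x, y)]_w
     (`|Num.min (Num.max (- deltaR x y w) 0) eps| ^+ 2)%:E)%E.

Definition pi0 (x y : S) : \bar R := P (x, y) [set w | newdist w = 0].

End coupling.

(* Functions on (0, oo) or [0, oo) are represented by total functions R -> R
   whose values elsewhere are irrelevant: ubeta is the upper bound of beta,
   lalpha and lpi are the lower bounds of alpha and pi. *)
Section construction.
Context (R : realType).
Variables (eps r0 a r2 : R) (ubeta lalpha lpi gamma : R -> R).

Local Notation mu := (@lebesgue_measure R).

Definition Ihat (s : R) : set R := `]s, s + eps[ `&` `]r0, +oo[.

Definition gammabar (r : R) : R := 2 * ubeta r / lalpha r.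

Definition r1 : R := sup [set r | 0 < r /\ 0 < gamma r].

Definition phi (r : R) : R := expR (- \int[mu]_(s in `[0, r]) gamma s).

Definition Phi (r : R) : R := \int[mu]_(s in `[0, r]) phi s.

(* Real suprema satisfy sup set0 = 0, which is the relevant value when Ihat s is
   empty (s + eps <= r0): these are suprema of positive quantities. *)
Definition weight (s : R) : R :=
  (phi s)^-1 * sup [set (a + Phi u) / lalpha u | u in Ihat s].

Definition rate : R :=
  Num.min (2^-1 * inf [set lpi r | r in `]0, r0]])
          (4^-1 * (\int[mu]_(s in `[0, r2]) weight s)^-1).

Definition grho (r : R) : R :=
  1 - 2 * rate * \int[mu]_(s in `[0, r]) weight s.

Definition frho (r : R) : R :=
  a * (0 < r)%R%:R +
  \int[mu]_(s in `[0, r]) (phi (Num.min s r2) * grho (Num.min s r2)).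

(* The range (r1, r2) of integration is cut at r0, which changes nothing if
   r0 <= r1: the assumptions control lalpha from below on (r0, oo) only, and if
   r1 < r0 the contraction estimate fails when lalpha is tiny (or 0) on (0, r0).
   Inverses are taken in the extended reals, so that 0^-1 = +oo. *)
Definition r2_condition : Prop :=
  forall r : R, r2 <= r ->
    ((2^-1)%:E *
       (\int[mu]_(s in `]r1, r2[ `&` `]r0, +oo[)
          (Phi s / lalpha s)%:E)^-1 <=
     (- (ubeta r / (a + Phi r)))%:E)%E.

End construction.

(* Main.v *)
Require Import Defs.
From HB Require Import structures.
From mathcomp Require Import all_boot all_order all_algebra.
From mathcomp Require Import all_classical all_reals all_analysis.
From mathcomp Require Import measurable_realfun ring lra.

Set Implicit Arguments.
Unset Strict Implicit.
Unset Printing Implicit Defensive.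

Import Order.TTheory GRing.Theory Num.Theory.
Import numFieldNormedType.Exports.

Local Open Scope classical_set_scope.
Local Open Scope ring_scope.

(** The profile [f] jumps from 0 to [a] at the origin and is then concave, with
    slope [F = phi * grho] up to [r2] and constant slope beyond.  Let [r] be the
    distance of [x] and [y], and [R'] the distance after one step.  Concavity
    gives the tangent bound [f R' <= f r + F r * (R' - r)], whose expectation is
    [f r + F r * beta].  It must be improved to [(1 - c) * f r], and there are
    three sources of improvement, one for each range of distances.

    - For [r <= r0] the tangent bound can be lowered by [a] on the event
      [R' = 0], because of the jump.  The expected gain [a * pi] beats the drift
      by the choice of [a] ([near_balance]).

    - For [r0 < r <= r2] the slope increases steeply to the left of [r]: on
      [(r - eps, r)] it satisfies [F s - F r >= K * (r - s)] with
      [K = (2 * max(ubeta r, 0) * F r + 2 * c * (a + Phi r)) / lalpha r]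
      ([slope_steep]).  Here the first term comes from [gamma >= gammabar] and
      [phi' = - gamma * phi], and the second from the definition of [grho]; both
      hold on the whole interval because [gamma] and the weight in [grho]
      involve suprema over forward windows, all of which contain [r].  As [f] is
      the primitive of [F], the tangent bound improves by [K / 2] times the
      square of the decrease of the distance truncated at [eps]
      ([jump_profile_steep]).  In expectation this is at least
      [K / 2 * lalpha r = max(ubeta r, 0) * F r + c * (a + Phi r)], and
      [f <= a + Phi], so the drift is compensated and [c * f r] is gained
      ([middle_balance]).  No second derivative of [f] is involved.

    - For [r > r2] the drift is negative, and the choice of [r2] makes it
      sufficient ([far_balance]).  One has to compare the integral of
      [Phi / lalpha] in the condition on [r2] with the integral of the weight in
      the rate ([critical_integral_le]).  The forward window of [s] does not
      contain [s], so the integrands compare only outside an exceptional set,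
      which is countable ([countable_forward_sup_lt]).

    Taking expectations is a matter of linearity ([drift_integral_le]), once
    [R'] is known to be measurable, which is where separability of the space
    comes in ([measurable_newdist]). *)

(** * Primitives of locally integrable functions *)

Section primitives.
Context {R : realType}.
Local Notation mu := (@lebesgue_measure R).
Implicit Types (k : R -> R) (u v m K : R).

Definition locally_integrable k :=
  forall r, 0 <= r -> mu.-integrable `[0, r] (EFin \o k).

Definition primitive k (r : R) : R := \int[mu]_(s in `[0, r]) k s.

Lemma locally_integrableS k (A : set R) r : measurable A -> locally_integrable k ->
  0 <= r -> A `<=` `[0, r] -> mu.-integrable A (EFin \o k).
Proof. by move=> mA ik r0 Ar; exact: integrableS (ik _ r0). Qed.

Lemma bounded_locally_integrable k :
  (forall r, 0 <= r -> measurable_fun (`[0, r] : set R) k) ->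
  (forall r, 0 <= r -> exists M, forall s, 0 <= s <= r -> `|k s| <= M) ->
  locally_integrable k.
Proof.
move=> mk bk r r0.
apply: measurable_bounded_integrable => //.
- by rewrite /= lebesgue_measure_itv/= lte_fin; case: ifP => _; rewrite ?ltry.
- exact: mk.
- have [M Mk] := bk _ r0; exists M; split; rewrite ?num_real// => x Mx s /=.
  by rewrite in_itv/= => /Mk /le_trans; apply; exact: ltW.
Qed.

Lemma nonincreasing_locally_integrable k :
  {in `[0, +oo[ &, {homo k : s t /~ s <= t}} -> locally_integrable k.
Proof.
move=> dk.
have dk' s t : 0 <= s -> s <= t -> k t <= k s.
  by move=> s0 st; apply: dk; rewrite ?in_itv/= ?andbT//; exact: le_trans st.
apply: bounded_locally_integrable => r r0.
- apply: (eq_measurable_fun (fun s : R => k (Num.max 0 s))).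
    by move=> s; rewrite inE/= in_itv/= => /andP[s0 _]; rewrite max_r.
  apply: measurable_realfun.nonincreasing_measurable => // s t st.
  by apply: dk'; [rewrite le_max lexx|rewrite ge_max !le_max lexx st orbT].
- exists (`|k 0| + `|k r|) => s /andP[s0 sr].
  have := dk' _ _ (lexx _) s0; have := dk' _ _ s0 sr.
  have := ler_norm (k 0); have := ler_norm (- k r); rewrite normrN => h1 h2 h3 h4.
  by rewrite ler_norml; have := normr_ge0 (k 0); have := normr_ge0 (k r); lra.
Qed.

Lemma primitiveB k u v : locally_integrable k -> 0 <= u -> u <= v ->
  primitive k v - primitive k u = \int[mu]_(s in `]u, v[) k s.
Proof.
move=> ik u0 uv; have v0 := le_trans u0 uv.
rewrite /primitive Rintegral_itvB ?bnd_simp//; last exact: ik.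
rewrite -Rintegral_itv_bndo_bndc//.
apply: (locally_integrableS _ ik v0) => // s /=.
by rewrite !in_itv/= => /andP[us sv]; rewrite (le_trans u0 (ltW us)) ltW.
Qed.

Let affine_continuous v m K : continuous (fun s : R => m + K * (v - s)).
Proof.
move=> s; apply: cvgD; first exact: cvg_cst.
by apply: cvgM; [exact: cvg_cst|apply: cvgB; [exact: cvg_cst|exact: cvg_id]].
Qed.

Lemma integrable_affine u v m K :
  mu.-integrable `]u, v[ (EFin \o (fun s => m + K * (v - s))).
Proof.
apply: (@integrableS _ _ _ mu `[u, v]) => //; first exact: subset_itvW.
apply: continuous_compact_integrable; first exact: segment_compact.
exact/continuous_subspaceT/affine_continuous.
Qed.

Lemma integral_affine u v m K : u <= v ->
  \int[mu]_(s in `]u, v[) (m + K * (v - s)) = m * (v - u) + K * (v - u) ^+ 2 / 2.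
Proof.
rewrite le_eqVlt => /predU1P[<-|uv].
  by rewrite set_itvoo0 Rintegral_set0 subrr expr0n !mulr0 mul0r addr0.
pose F (s : R) := - (m * (v - s) + K / 2 * (v - s) ^+ 2).
have dF (s : R) : is_derive (s : R^o) (1 : R^o) (F : R^o -> R^o) (m + K * (v - s)).
  rewrite /F; apply: is_derive_eq; rewrite /GRing.scale/=.
  by field.
have cF : continuous F.
  by move=> s; apply: differentiable_continuous; apply/derivable1_diffP; case: (dF s).
rewrite Rintegral_itv_bndo_bndc; last exact: integrable_affine.
rewrite Rintegral_itv_obnd_cbnd; last first.
  apply: (@integrableS _ _ _ mu `[u, v]) => //; first exact: subset_itv_oc_cc.
  apply: continuous_compact_integrable; first exact: segment_compact.
  exact/continuous_subspaceT/affine_continuous.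
rewrite /Rintegral (@continuous_FTC2 _ _ F)//.
- by rewrite /F/= subrr; field.
- exact/continuous_subspaceT/affine_continuous.
- split.
  + by move=> s _; case: (dF s).
  + exact/cvg_at_right_filter/cF.
  + exact/cvg_at_left_filter/cF.
- by move=> s _; rewrite derive1E; case: (dF s).
Qed.

(** This is where second-order gains come from: a slope that exceeds its value [m]
at the right end by at least [K] times the distance to that end raises the
increment quadratically.  It does the work of a bound [- K] on the second
derivative of the primitive, which need not exist. *)
Lemma primitive_ge_affine k u v m K : locally_integrable k -> 0 <= u -> u <= v ->
  (forall s, u < s < v -> m + K * (v - s) <= k s) ->
  m * (v - u) + K * (v - u) ^+ 2 / 2 <= primitive k v - primitive k u.
Proof.
move=> ik u0 uv mk.
rewrite primitiveB// -integral_affine//; apply: le_Rintegral => //.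
- exact: integrable_affine.
- apply: (locally_integrableS _ ik (le_trans u0 uv)) => // s /=.
  by rewrite !in_itv/= => /andP[us sv]; rewrite (le_trans u0 (ltW us)) ltW.
Qed.

Lemma primitive_ge k u v m : locally_integrable k -> 0 <= u -> u <= v ->
  (forall s, u < s < v -> m <= k s) ->
  m * (v - u) <= primitive k v - primitive k u.
Proof.
move=> ik u0 uv mk; have := @primitive_ge_affine k u v m 0 ik u0 uv.
by rewrite !mul0r addr0; apply=> s /mk; rewrite mul0r addr0.
Qed.

Lemma primitive_le k u v m : locally_integrable k -> 0 <= u -> u <= v ->
  (forall s, u < s < v -> k s <= m) ->
  primitive k v - primitive k u <= m * (v - u).
Proof.
move=> ik u0 uv mk.
have h : mu.-integrable `]u, v[ (EFin \o k).
  apply: (locally_integrableS _ ik (le_trans u0 uv)) => // s /=.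
  by rewrite !in_itv/= => /andP[us sv]; rewrite (le_trans u0 (ltW us)) ltW.
rewrite primitiveB//.
have := @integral_affine u v m 0 uv; rewrite !mul0r addr0 => <-.
apply: le_Rintegral => //; first exact: integrable_affine.
by move=> s /=; rewrite in_itv/= mul0r addr0; exact: mk.
Qed.

Lemma primitive0 k : primitive k 0 = 0.
Proof. by rewrite /primitive set_itv1 Rintegral_set1. Qed.

Lemma primitive_ge0 k r : (forall s, 0 <= s -> 0 <= k s) -> 0 <= primitive k r.
Proof.
move=> k0; apply: Rintegral_ge0 => s /=.
by rewrite in_itv/= => /andP[s0 _]; exact: k0.
Qed.

Lemma primitive_homo k u v : locally_integrable k -> (forall s, 0 <= s -> 0 <= k s) ->
  0 <= u -> u <= v -> primitive k u <= primitive k v.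
Proof.
move=> ik k0 u0 uv; rewrite -subr_ge0 -(mul0r (v - u)).
by apply: primitive_ge => // s /andP[us _]; apply/k0/(le_trans u0)/ltW.
Qed.

End primitives.

(** * Integrals of non-measurable integrands *)

Section lower_integral.
Context d (T : measurableType d) (R : realType).
Variable mu : {measure set T -> \bar R}.
Import HBNNSimple.
Local Open Scope ereal_scope.

(** The integral of a nonnegative function is by definition a supremum over the
simple functions below it, so monotonicity only asks the larger function to be
measurable.  The function [lalpha] is arbitrary, hence so is the integrand in
the condition on [r2]. *)
Lemma ae_ge0_le_lower_integral (D : set T) (f g : T -> \bar R) : measurable D ->
  (forall x, D x -> 0 <= f x) -> (forall x, D x -> 0 <= g x) ->
  measurable_fun D g -> {ae mu, forall x, D x -> f x <= g x} ->
  \int[mu]_(x in D) f x <= \int[mu]_(x in D) g x.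
Proof.
move=> mD f0 g0 mg fg; rewrite ge0_integralE//=.
apply: ge_ereal_sup => _ [h /= hf <-].
rewrite -integralT_nnsfun [leRHS]integral_mkcond.
apply: ae_ge0_le_integral => //.
- by move=> x _; rewrite lee_fin; exact: fun_ge0.
- exact/measurable_EFinP.
- by move=> x _; apply: erestrict_ge0 => y; exact: g0.
- exact/(measurable_restrictT _ mD).1.
- apply: filterS fg => x fgx _; apply: (le_trans (hf x)).
  by rewrite /patch; case: ifP => // /set_mem /fgx.
Qed.

End lower_integral.

(** * Suprema over a forward window *)

Section forward_supremum.
Context {R : realType}.
Variables (eps r0 : R) (h : R -> R).
Hypothesis eps0 : 0 < eps.
Hypothesis h_ge0 : forall u, r0 < u -> 0 <= h u.
Hypothesis h_bounded : forall s, has_ubound [set h u | u in Ihat eps r0 s].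

Definition forward_sup s := sup [set h u | u in Ihat eps r0 s].

Lemma IhatP s u : Ihat eps r0 s u <-> [/\ r0 < u, s < u & u < s + eps].
Proof.
rewrite /Ihat/= !in_itv/= andbT.
by split=> [[/andP[-> ->] ->]//|[-> -> ->]].
Qed.

Lemma le_forward_sup s u : r0 < u -> s < u -> u < s + eps -> h u <= forward_sup s.
Proof.
by move=> r0u su us; apply: ub_le_sup => //; exists u => //; apply/IhatP.
Qed.

Lemma forward_sup_le s M : 0 <= M ->
  (forall u, r0 < u -> s < u -> u < s + eps -> h u <= M) -> forward_sup s <= M.
Proof.
move=> M0 hM; rewrite /forward_sup.
have [->|/set0P ne] := eqVneq [set h u | u in Ihat eps r0 s] set0.
  by rewrite sup0.
by apply: ge_sup => // _ [u /IhatP[? ? ?] <-]; exact: hM.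
Qed.

Lemma forward_sup_ge0 s : 0 <= forward_sup s.
Proof.
rewrite /forward_sup.
have [->|/set0P[_ [u /IhatP[? ? ?] _]]] := eqVneq [set h u | u in Ihat eps r0 s] set0.
  by rewrite sup0.
by apply: le_trans (le_forward_sup (s := s) (u := u) _ _ _) => //; exact: h_ge0.
Qed.

(** The forward supremum is lower semicontinuous: the points where it exceeds
[t >= 0] are those whose window meets the set where [h > t], and they form a
union of open intervals of length [eps]. *)
Lemma measurable_forward_sup : measurable_fun [set: R] forward_sup.
Proof.
apply: (measurability (@RGenOInfty.G R)) => [|/= _ [_] [t] -> <-].
  exact: RGenOInfty.measurableE.
rewrite setTI; have [t0|t0] := ltP t 0.
  rewrite (_ : _ @^-1` _ = setT)//.
  apply/seteqP; split=> // s _ /=; rewrite in_itv/= andbT.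
  by rewrite (lt_le_trans t0)// forward_sup_ge0.
rewrite (_ : _ @^-1` _ = \bigcup_(u in [set u | r0 < u /\ t < h u]) `]u - eps, u[%classic).
  by apply: open_measurable; apply: bigcup_open => u _; exact: interval_open.
apply/seteqP; split => s /=; rewrite in_itv/= andbT.
  move=> ts; apply: contrapT => no; move: ts; apply/negP; rewrite -leNgt.
  apply: forward_sup_le => // u r0u su us; rewrite leNgt; apply/negP => tu.
  by apply: no; exists u => //=; rewrite in_itv/= su andbT ltrBlDr.
move=> [u [r0u tu]] /=; rewrite in_itv/= ltrBlDr => /andP[us su].
exact: lt_le_trans tu (le_forward_sup _ _ _).
Qed.

(** A window does not contain its own left end [s], so [h s] may exceed the
supremum over it.  Among the points where a given rational [q] separates the
two values, no two are within [eps] of each other, since the right one would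
lie in the window of the left one and have [h < q] there.  There are countably
many such points for each [q]. *)
Lemma countable_forward_sup_lt : countable [set s | r0 < s /\ forward_sup s < h s].
Proof.
pose B (q : rat) := [set s : R | [/\ r0 < s, forward_sup s < ratr q & ratr q < h s]].
apply: (@sub_countable _ _ _ (\bigcup_(q in [set: rat]) B q)).
  apply: subset_card_le => s [r0s sh].
  have [q] := rat_in_itvoo sh; rewrite in_itv/= => /andP[sq qs].
  by exists q.
apply: bigcup_countable => [|q _]; first exact: countableP.
(* Points at distance [eps] or more have distinct cells in the grid of mesh [eps]. *)
apply/countable_injP; exists (fun s => pickle (Num.floor (s / eps))) => s t.
rewrite !inE => Bs Bt /(pcan_inj (@pickleK _)) st.
have {st} st : `|s - t| < eps.
  have es := floor_itv (s / eps); have et := floor_itv (t / eps).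
  rewrite st in es; move: es et => /andP[s1 s2] /andP[t1 t2].
  rewrite intrD in s2 t2.
  have : `|(s - t) / eps| < 1 by rewrite ltr_norml mulrBl; lra.
  by rewrite normrM normfV (gtr0_norm eps0) ltr_pdivrMr// mul1r.
have sep x y : B q x -> B q y -> `|x - y| < eps -> ~ x < y.
  move=> [r0x xq qx] [r0y yq qy] xy ltxy.
  suff : h y <= forward_sup x by lra.
  by apply: le_forward_sup => //; move: xy; rewrite ltr_norml; lra.
have [ | |//] := ltgtP s t; first by move/(sep _ _ Bs Bt st).
by rewrite distrC in st; move/(sep _ _ Bt Bs st).
Qed.

End forward_supremum.

(** * Concave profiles with a jump at the origin *)

Section jump_profile.
Context {R : realType}.
Variables (a : R) (F : R -> R).
Hypothesis a_ge0 : 0 <= a.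
Hypothesis F_gt0 : forall s, 0 <= s -> 0 < F s.
Hypothesis F_noninc : forall s t, 0 <= s -> s <= t -> F t <= F s.

Definition jump_profile (r : R) : R := a * (0 < r)%R%:R + primitive F r.

Lemma locally_integrable_slope : locally_integrable F.
Proof.
apply: nonincreasing_locally_integrable => s t; rewrite !in_itv/= !andbT => _.
exact: F_noninc.
Qed.
Local Notation iF := locally_integrable_slope.

Lemma jump_profile0 : jump_profile 0 = 0.
Proof. by rewrite /jump_profile ltxx mulr0 primitive0 addr0. Qed.

Lemma jump_profile_ge0 r : 0 <= jump_profile r.
Proof.
apply: addr_ge0; first by rewrite mulr_ge0.
by apply: primitive_ge0 => s /F_gt0 /ltW.
Qed.

Lemma jump_profile_lt r s : 0 <= r -> r < s -> jump_profile r < jump_profile s.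
Proof.
move=> r0 rs; have s0 := le_lt_trans r0 rs.
rewrite /jump_profile s0; apply: ler_ltD.
  by rewrite ler_wpM2l// lern1 leq_b1.
rewrite -subr_gt0; apply: (@lt_le_trans _ _ (F s * (s - r))).
  by rewrite mulr_gt0 ?subr_gt0// F_gt0// ltW.
apply: primitive_ge => //; [exact: iF|exact: ltW|].
by move=> t /andP[rt ts]; apply: F_noninc; [exact: le_trans (ltW rt)|exact: ltW].
Qed.

Lemma primitive_tangent x r : 0 <= x -> 0 <= r ->
  primitive F x <= primitive F r + F r * (x - r).
Proof.
move=> x0 r0; have [xr|/ltW rx] := leP x r.
  have : F r * (r - x) <= primitive F r - primitive F x.
    apply: primitive_ge => //; first exact: iF.
    by move=> t /andP[xt tr]; apply: F_noninc; [exact: le_trans (ltW xt)|exact: ltW].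
  lra.
have : primitive F x - primitive F r <= F r * (x - r).
  apply: primitive_le => //; first exact: iF.
  by move=> t /andP[rt _]; apply: F_noninc => //; exact: ltW.
lra.
Qed.

(** A nonincreasing slope puts the profile below its tangent lines, and below them
by the whole jump [a] at the origin.  The jump is thus the reward for a
coalescence of the two points. *)
Lemma jump_profile_tangent x r : 0 <= x -> 0 < r ->
  jump_profile x <= jump_profile r + F r * (x - r) - a * (x == 0)%:R.
Proof.
move=> x0 r0; have := primitive_tangent x0 (ltW r0).
rewrite /jump_profile r0 mulr1 lt_neqAle x0 andbT eq_sym.
by case: (eqVneq x 0) => _ /=; rewrite ?mulr1 ?mulr0; lra.
Qed.

(** Going down from [r], the last stretch of length at most [e] has a slope that
exceeds [F r] linearly, which costs a quadratic amount; farther down only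
monotonicity of the slope is used. *)
Lemma jump_profile_steep e K x r : 0 < e -> 0 <= K -> 0 <= x -> 0 < r ->
  (forall s, 0 <= s -> r - e < s -> s < r -> K * (r - s) <= F s - F r) ->
  jump_profile x <= jump_profile r + F r * (x - r)
    - K / 2 * (Num.min (Num.max (r - x) 0) e) ^+ 2.
Proof.
move=> e0 K0 x0 r0 steep; have [xr|rx] := ltP x r; last first.
  rewrite max_r ?subr_le0// min_l ?(ltW e0)// expr0n mulr0 subr0.
  apply: (le_trans (jump_profile_tangent x0 r0)).
  by rewrite gerBl mulr_ge0.
have xr0 : 0 <= r - x by rewrite subr_ge0 ltW.
rewrite max_l//; set D := Num.min (r - x) e.
have D0 : 0 <= D by rewrite /D le_min xr0 ltW.
have De : D <= e by rewrite /D ge_min lexx orbT.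
have Dx : D <= r - x by rewrite /D ge_min lexx.
have h1 : F r * (r - (r - D)) + K * (r - (r - D)) ^+ 2 / 2
    <= primitive F r - primitive F (r - D).
  apply: primitive_ge_affine; [exact: iF|lra|lra|].
  by move=> s /andP[s1 s2]; rewrite addrC -lerBrDr; apply: steep => //; lra.
have h2 : F r * (r - D - x) <= primitive F (r - D) - primitive F x.
  apply: primitive_ge; [exact: iF| |lra|] => //.
  by move=> s /andP[s1 s2]; apply: F_noninc; lra.
have h3 : a * (0 < x)%R%:R <= a by rewrite ler_piMr// lern1 leq_b1.
rewrite /jump_profile r0 mulr1; move: h1; rewrite subKr => h1.
have -> : K / 2 * D ^+ 2 = K * D ^+ 2 / 2 by rewrite mulrAC.
lra.
Qed.

(** The jump does not spoil concavity because it sits at the end point of the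
interval: tangent lines exist at every [z > 0], and a convex combination of
points of [[0, +oo[] vanishes only if each term does. *)
Lemma jump_profile_concave : concave_function `[0, +oo[ jump_profile.
Proof.
move=> t x y; rewrite !inE/= !in_itv/= !andbT => x0 y0.
have t0 : 0 <= t%:num by []. have t1 : t%:num <= 1 by [].
change (- jump_profile (t%:num * x + (1 - t%:num) * y)
  <= t%:num * - jump_profile x + (1 - t%:num) * - jump_profile y).
move: (t%:num) t0 t1 => l l0 l1; set z := l * x + (1 - l) * y.
have lx : 0 <= l * x by rewrite mulr_ge0.
have ly : 0 <= (1 - l) * y by rewrite mulr_ge0// subr_ge0.
have [z0|] := ltP 0 z.
  have hx : jump_profile x <= jump_profile z + F z * (x - z).
    by apply: (le_trans (jump_profile_tangent x0 z0)); rewrite gerBl mulr_ge0.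
  have hy : jump_profile y <= jump_profile z + F z * (y - z).
    by apply: (le_trans (jump_profile_tangent y0 z0)); rewrite gerBl mulr_ge0.
  have {}hx := ler_wpM2l l0 hx.
  have {}hy : (1 - l) * jump_profile y <= (1 - l) * (jump_profile z + F z * (y - z)).
    by apply: ler_wpM2l hy; rewrite subr_ge0.
  have : l * (jump_profile z + F z * (x - z)) + (1 - l) * (jump_profile z + F z * (y - z))
      = jump_profile z by rewrite /z; ring.
  lra.
have jp u v : v * u = 0 -> v * jump_profile u = 0.
  move/eqP; rewrite mulf_eq0 => /orP[/eqP ->|/eqP ->]; first by rewrite mul0r.
  by rewrite jump_profile0 mulr0.
move=> z0; rewrite (_ : z = 0); last by apply/eqP; rewrite eq_le z0 addr_ge0.
have /jp jx : l * x = 0 by rewrite /z in z0; lra.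
have /jp jy : (1 - l) * y = 0 by rewrite /z in z0; lra.
by rewrite !mulrN jx jy jump_profile0 oppr0 addr0.
Qed.

End jump_profile.

(** * The discount factor *)

Section discount.
Context {R : realType}.
Variable gamma : R -> R.
Hypothesis gamma_ge0 : forall s, 0 <= s -> 0 <= gamma s.
Hypothesis gamma_int : locally_integrable gamma.
Hypothesis r1_bounded : has_ubound [set r | 0 < r /\ 0 < gamma r].

Lemma phi_gt0 s : 0 < phi gamma s. Proof. exact: expR_gt0. Qed.

Lemma phi_le1 s : phi gamma s <= 1.
Proof. by rewrite -[leRHS]expR0 ler_expR oppr_le0 primitive_ge0. Qed.

Lemma phi_ratio s t : phi gamma s = phi gamma t * expR (primitive gamma t - primitive gamma s).
Proof. by rewrite -expRD addrA addNr add0r. Qed.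

Lemma phi_noninc s t : 0 <= s -> s <= t -> phi gamma t <= phi gamma s.
Proof. by move=> s0 st; rewrite ler_expR lerN2; exact: primitive_homo. Qed.

(** The inequality [1 + x <= exp x] turns a lower bound on [gamma] into a lower
bound on the decrease of [phi]. *)
Lemma phi_drop s t m : 0 <= s -> s <= t -> (forall u, s < u < t -> m <= gamma u) ->
  phi gamma t * (m * (t - s)) <= phi gamma s - phi gamma t.
Proof.
move=> s0 st mg; rewrite (phi_ratio s t) -{3}[phi gamma t]mulr1 -mulrBr.
rewrite ler_pM2l ?phi_gt0//; apply: (le_trans (primitive_ge gamma_int s0 st mg)).
by rewrite lerBrDl; exact: expR_ge1Dx.
Qed.

Lemma r1_ge0 : 0 <= r1 gamma.
Proof.
rewrite /r1; have [->|/set0P[r [r0 gr]]] := eqVneq [set r | 0 < r /\ 0 < gamma r] set0.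
  by rewrite sup0.
by apply: (le_trans (ltW r0)); exact: ub_le_sup.
Qed.

(** [gamma] vanishes beyond [r1]. *)
Lemma phi_const s t : r1 gamma < s -> s <= t -> phi gamma s = phi gamma t.
Proof.
move=> r1s st; have s0 := le_lt_trans r1_ge0 r1s.
have g0 u : s < u < t -> gamma u <= 0.
  move=> /andP[su _]; rewrite leNgt; apply/negP => gu.
  have : u <= r1 gamma by apply: ub_le_sup => //; split=> //; exact: lt_trans su.
  by rewrite leNgt (lt_trans r1s su).
have h1 := primitive_le gamma_int (ltW s0) st g0.
have h2 := primitive_homo gamma_int gamma_ge0 (ltW s0) st.
by rewrite (phi_ratio s t) (_ : _ - _ = 0) ?expR0 ?mulr1//; lra.
Qed.

Lemma locally_integrable_phi : locally_integrable (phi gamma).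
Proof.
apply: nonincreasing_locally_integrable => s t; rewrite !in_itv/= !andbT => _ t0.
exact: phi_noninc.
Qed.

Lemma Phi_ge0 r : 0 <= Phi gamma r.
Proof. by apply: primitive_ge0 => s _; exact/ltW/phi_gt0. Qed.

Lemma Phi_le r : 0 <= r -> Phi gamma r <= r.
Proof.
move=> r0; have := @primitive_le _ (phi gamma) 0 r 1 locally_integrable_phi (lexx _) r0.
by rewrite primitive0 !subr0 mul1r; apply=> s _; exact: phi_le1.
Qed.

End discount.

(** * The slope of the profile and the rate *)

Section construction_facts.
Context {R : realType}.
Variables (eps r0 a r2 : R) (ubeta lalpha lpi gamma : R -> R).
Hypothesis eps0 : 0 < eps.
Hypothesis r00 : 0 < r0.
Hypothesis a0 : 0 < a.
Hypothesis lalpha_ge0 : forall r, 0 < r -> 0 <= lalpha r.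
Hypothesis pi_away : 0 < inf [set lpi r | r in `]0, r0]].
Hypothesis lalpha_away : forall s, r0 < s -> 0 < inf [set lalpha r | r in `]r0, s[].
Hypothesis gamma_ge0 : forall s, 0 <= s -> 0 <= gamma s.
Hypothesis gamma_int : locally_integrable gamma.
Hypothesis gamma_sup : forall s, 0 <= s ->
  (ereal_sup [set (gammabar ubeta lalpha r)%:E | r in Ihat eps r0 s] <= (gamma s)%:E)%E.
Hypothesis r1_bounded : has_ubound [set r | 0 < r /\ 0 < gamma r].
Hypothesis r12 : r1 gamma < r2.
Hypothesis far_away : r2_condition r0 a r2 ubeta lalpha gamma.

Local Notation mu := (@lebesgue_measure R).
Local Notation phi := (phi gamma).
Local Notation Phi := (Phi gamma).
Local Notation J := (primitive (weight eps r0 a lalpha gamma)).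
Local Notation c := (rate eps r0 a r2 lalpha lpi gamma).
Local Notation g := (grho eps r0 a r2 lalpha lpi gamma).

Let h (u : R) := (a + Phi u) / lalpha u.

Lemma inf_le_lalpha s u : r0 < u < s -> inf [set lalpha r | r in `]r0, s[] <= lalpha u.
Proof.
move=> us; apply: ge_inf; last by exists u => //=; rewrite in_itv.
exists 0 => _ [r /= rI <-]; move: rI; rewrite in_itv/= => /andP[r0r _].
by apply/lalpha_ge0/(lt_trans r00).
Qed.

Lemma lalpha_gt0 u : r0 < u -> 0 < lalpha u.
Proof.
move=> r0u; have u1 : u < u + 1 by rewrite ltrDl.
apply: (lt_le_trans (lalpha_away (lt_trans r0u u1))).
by apply: inf_le_lalpha; rewrite r0u.
Qed.

Lemma aPhi_gt0 u : 0 < a + Phi u.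
Proof. by rewrite ltr_wpDr// Phi_ge0. Qed.

Let h_ge0 u : r0 < u -> 0 <= h u.
Proof. by move=> r0u; rewrite divr_ge0 ?ltW ?aPhi_gt0 ?lalpha_gt0. Qed.

(** [lalpha] is bounded away from 0 on bounded subsets of [(r0, oo)], which makes
all the suprema in the weight finite. *)
Let h_bound (t : R) : exists2 M : R, 0 <= M & forall u : R, r0 < u -> u < t -> h u <= M.
Proof.
have [tr0|r0t] := lerP t r0.
  by exists 0 => // u r0u ut; lra.
have at0 : 0 <= a + t by have := a0; have := r00; lra.
have i0 := lalpha_away r0t; set i := inf _ in i0.
exists ((a + t) / i); first by apply: divr_ge0; [|exact: ltW].
move=> u r0u ut; apply: ler_pM.
- exact/ltW/aPhi_gt0.
- by rewrite invr_ge0 ltW// lalpha_gt0.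
- rewrite lerD2l (le_trans (Phi_le _ _ _)) ?(ltW ut)//; exact/ltW/(lt_trans r00).
- by rewrite lef_pV2 ?posrE ?lalpha_gt0//; apply: inf_le_lalpha; rewrite r0u.
Qed.

Let h_bounded s : has_ubound [set h u | u in Ihat eps r0 s].
Proof.
have [M _ hM] := h_bound (s + eps).
by exists M => _ [u /IhatP[? ? ?] <-]; exact: hM.
Qed.

Let H := forward_sup eps r0 h.

Let weightE s : weight eps r0 a lalpha gamma s = (phi s)^-1 * H s.
Proof. by []. Qed.

Lemma weight_ge0 s : 0 <= weight eps r0 a lalpha gamma s.
Proof.
by rewrite weightE; apply: mulr_ge0; [by rewrite invr_ge0 ltW ?phi_gt0|exact: forward_sup_ge0].
Qed.

Lemma locally_integrable_weight : locally_integrable (weight eps r0 a lalpha gamma).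
Proof.
apply: bounded_locally_integrable => r r_ge0.
  apply: measurable_funM; last first.
    by apply: measurable_funTS; exact: measurable_forward_sup.
  have -> : (fun s => (phi s)^-1) = expR \o primitive gamma.
    by apply/funext => s; rewrite /= -expRN opprK.
  apply: measurableT_comp => //.
  have iN : locally_integrable (fun s => - primitive gamma s).
    apply: nonincreasing_locally_integrable => s t.
    by rewrite !in_itv/= !andbT => _ t0 ts; rewrite lerN2; exact: primitive_homo.
  have /measurable_int/measurable_EFinP/measurable_funN := iN r r_ge0.
  by apply: eq_measurable_fun => s _ /=; rewrite opprK.
have [M M0 hM] := h_bound (r + eps).
exists ((phi r)^-1 * M) => s /andP[s0 sr].
rewrite ger0_norm ?weight_ge0// weightE; apply: ler_pM.
- by rewrite invr_ge0 ltW ?phi_gt0.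
- exact: forward_sup_ge0.
- by rewrite lef_pV2 ?posrE ?phi_gt0//; exact: phi_noninc.
- apply: forward_sup_le => // u r0u su us; apply: hM => //.
  by apply: (lt_le_trans us); rewrite lerD2r.
Qed.
Local Notation iw := locally_integrable_weight.

(** The point of taking suprema over forward windows: the weight at [s] controls
[(a + Phi u) / lalpha u] for every [u] that can be reached from [s] by a step
up of length less than [eps], hence, seen from [u], on the whole stretch that
a truncated step down from [u] crosses. *)
Lemma weight_ge s u : r0 < u -> s < u -> u < s + eps ->
  (a + Phi u) / lalpha u <= phi s * weight eps r0 a lalpha gamma s.
Proof.
move=> r0u su us; rewrite weightE mulrA mulfV ?gt_eqF ?phi_gt0// mul1r.
exact: (le_forward_sup h_bounded r0u su us).
Qed.

(** Beyond [r1] the function [phi] is constant, and [Phi / lalpha] is at most the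
forward supremum except at countably many points. *)
Lemma critical_integral_le :
  (\int[mu]_(s in (`]r1 gamma, r2[ `&` `]r0, +oo[)) (Phi s / lalpha s)%:E
    <= (phi r2 * J r2)%:E)%E.
Proof.
have r2_ge0 : 0 <= r2 by apply/ltW/(le_lt_trans _ r12)/r1_ge0.
set D := `]r1 gamma, r2[ `&` `]r0, +oo[.
have mD : measurable (D : set R) by exact: measurableI.
have D02 : D `<=` `[0, r2].
  move=> s [] /=; rewrite !in_itv/= => /andP[r1s /ltW ->] _.
  by rewrite andbT; apply/(le_trans _ (ltW r1s))/r1_ge0.
pose k s := phi r2 * weight eps r0 a lalpha gamma s.
have k0 s : 0 <= k s by rewrite mulr_ge0 ?weight_ge0// ltW ?phi_gt0.
have ik : mu.-integrable `[0, r2] (EFin \o k).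
  rewrite (_ : _ \o _ = fun s => ((phi r2)%:E * (weight eps r0 a lalpha gamma s)%:E)%E)//.
  by apply: integrableZl => //; exact: iw.
have -> : (phi r2 * J r2)%:E = (\int[mu]_(s in `[0%R, r2]) (k s)%:E)%E.
  rewrite -RintegralZl//; last exact: iw.
  by rewrite /Rintegral fineK//; exact: integrable_fin_num.
apply: (@le_trans _ _ (\int[mu]_(s in D) (k s)%:E)%E); last first.
  apply: ge0_subset_integral => //; last by move=> s _; rewrite lee_fin.
  exact: measurable_int ik.
apply: ae_ge0_le_lower_integral => //.
- move=> s [_ /=]; rewrite in_itv/= andbT => r0s.
  by rewrite lee_fin divr_ge0 ?Phi_ge0 ?ltW ?lalpha_gt0.
- by move=> s _; rewrite lee_fin.
- by apply: (@measurable_int _ _ _ mu); exact: integrableS ik.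
- have cN := countable_forward_sup_lt eps0 h_bounded.
  exists [set s | r0 < s /\ H s < h s]; split.
  + exact: countable_measurable.
  + exact: countable_lebesgue_measure0.
  + move=> s /= /not_implyP[[]]/=; rewrite !in_itv/= andbT => /andP[r1s sr2] r0s.
    move=> /negP; rewrite lee_fin -ltNge => ks; split=> //.
    apply: contraPP ks => /negP; rewrite -leNgt => hs; apply/negP; rewrite -leNgt.
    rewrite /k -(phi_const gamma_ge0 gamma_int r1_bounded r1s (ltW sr2)).
    rewrite weightE mulrA mulfV ?gt_eqF ?phi_gt0// mul1r; apply: le_trans hs.
    by rewrite ler_pM2r ?invr_gt0 ?lalpha_gt0// lerDr ltW.
Qed.

(** If [r2 <= r0], the integral in the condition on [r2] is over an empty set, and
its inverse is infinite, which no finite drift can match. *)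
Lemma r0_lt_r2 : r0 < r2.
Proof.
rewrite ltNge; apply/negP => r2r0; have := far_away (lexx r2).
rewrite (_ : `]r1 gamma, r2[ `&` `]r0, +oo[ = set0); last first.
  apply/seteqP; split=> // s [] /=; rewrite !in_itv/= andbT => /andP[_ sr2] r0s.
  by have := lt_trans r0s (lt_le_trans sr2 r2r0); rewrite ltxx.
by rewrite integral_set0 inve0 mulry gtr0_sg ?invr_gt0// mul1e.
Qed.

(** The witness is the integral in the condition on [r2]; it is finite by
[critical_integral_le], and nonzero because its inverse is finite. *)
Lemma far_drift : exists v : R, [/\ 0 < v, v <= phi r2 * J r2 &
  forall r, r2 <= r -> 2^-1 * v^-1 <= - (ubeta r / (a + Phi r))].
Proof.
have := critical_integral_le; have fa := far_away; rewrite /r2_condition in fa.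
set I := integral _ _ _ in fa *; move=> I_le.
have I0 : (0 <= I)%E.
  apply: integral_ge0 => s [_ /=]; rewrite in_itv/= andbT => r0s.
  by rewrite lee_fin divr_ge0 ?Phi_ge0 ?ltW ?lalpha_gt0.
have Ifin : I \is a fin_num by rewrite ge0_fin_numE// (le_lt_trans I_le) ?ltry.
exists (fine I); rewrite -lee_fin fineK//.
have In0 : fine I != 0.
  apply/eqP => I00; have := fa _ (lexx r2); rewrite -(fineK Ifin) I00.
  by rewrite inve0 mulry gtr0_sg ?invr_gt0// mul1e.
split=> //; first by rewrite lt_neqAle eq_sym In0 fine_ge0.
move=> r /fa; rewrite -(fineK Ifin) inver (negbTE In0) fineK//.
Qed.

Lemma Jr2_gt0 : 0 < J r2.
Proof.
have [v [v0 vJ _]] := far_drift.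
by have := lt_le_trans v0 vJ; rewrite pmulr_rgt0 ?phi_gt0.
Qed.

Lemma rate_gt0 : 0 < c.
Proof.
rewrite /rate lt_min; apply/andP; split; first by rewrite mulr_gt0 ?invr_gt0.
by rewrite mulr_gt0 ?invr_gt0 ?Jr2_gt0// invr_gt0 Jr2_gt0.
Qed.

Lemma rate_le_pi : 2 * c <= inf [set lpi r | r in `]0, r0]].
Proof.
by rewrite mulrC -ler_pdivlMr// mulrC /rate ge_min lexx.
Qed.

Lemma rate_le_J : c * J r2 <= 4^-1.
Proof.
by rewrite -ler_pdivlMr ?Jr2_gt0//; rewrite /rate ge_min lexx orbT.
Qed.

(** Only half of the slope [phi r2] is available beyond [r2]; the factors 1/2 in
the condition on [r2] and 1/4 in the rate make up for it. *)
Lemma rate_far r : r2 <= r -> c * (a + Phi r) <= - (phi r2 / 2 * ubeta r).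
Proof.
move=> r2r; have [v [v0 vJ /(_ _ r2r) vb]] := far_drift.
have aP := aPhi_gt0 r; have J0 := Jr2_gt0.
have c_le : c <= phi r2 / 4 * v^-1.
  apply: (@le_trans _ _ (4^-1 / J r2)); first by rewrite ler_pdivlMr ?rate_le_J.
  rewrite [phi r2 / 4]mulrC -mulrA ler_pM2l ?invr_gt0//.
  by rewrite ler_pdivlMr// mulrC ler_pdivrMr.
have -> : - (phi r2 / 2 * ubeta r) = phi r2 / 2 * (- (ubeta r / (a + Phi r))) * (a + Phi r).
  by field; rewrite gt_eqF.
rewrite ler_pM2r//; apply: (le_trans c_le).
have -> : phi r2 / 4 * v^-1 = phi r2 / 2 * (2^-1 * v^-1) by field; rewrite gt_eqF.
by rewrite ler_pM2l// divr_gt0 ?phi_gt0.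
Qed.

Lemma r2_gt0 : 0 < r2. Proof. exact: lt_trans r0_lt_r2. Qed.

Lemma grhoB s t : g s - g t = 2 * c * (J t - J s).
Proof. by rewrite /grho -/(J s) -/(J t); ring. Qed.

Lemma grho_noninc s t : 0 <= s -> s <= t -> g t <= g s.
Proof.
move=> s0 st; rewrite -subr_ge0 grhoB mulr_ge0 ?mulr_ge0 ?(ltW rate_gt0)// subr_ge0.
by apply: primitive_homo => //; [exact: iw|move=> u _; exact: weight_ge0].
Qed.

Lemma grho_le1 s : 0 <= s -> g s <= 1.
Proof.
move=> s0; apply: (le_trans (grho_noninc (lexx _) s0)).
by rewrite /grho -/(J 0) primitive0 mulr0 subr0.
Qed.

(** The rate is at most a quarter of the inverse of the total weight on
[[0, r2]], so [grho] loses at most one half there. *)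
Lemma grho_ge_half s : 0 <= s -> s <= r2 -> 2^-1 <= g s.
Proof.
move=> s0 sr2; apply: (le_trans _ (grho_noninc s0 sr2)).
by rewrite /grho -/(J r2); have := rate_le_J; lra.
Qed.

(** With this slope, [frho] is by definition [jump_profile a slope]. *)
Definition slope s := phi (Num.min s r2) * g (Num.min s r2).

Let min_ge0 s : 0 <= s -> 0 <= Num.min s r2.
Proof. by move=> s0; rewrite le_min s0 ltW ?r2_gt0. Qed.

Let min_r2 s : Num.min s r2 <= r2. Proof. by rewrite ge_min lexx orbT. Qed.

Lemma slope_gt0 s : 0 <= s -> 0 < slope s.
Proof.
move=> s0; rewrite mulr_gt0 ?phi_gt0//.
by apply: (lt_le_trans _ (grho_ge_half (min_ge0 s0) (min_r2 s))); rewrite invr_gt0.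
Qed.

Lemma slope_noninc s t : 0 <= s -> s <= t -> slope t <= slope s.
Proof.
move=> s0 st; have st2 : Num.min s r2 <= Num.min t r2.
  by rewrite le_min !ge_min st lexx orbT.
have t0 := le_trans s0 st; apply: ler_pM.
- exact/ltW/phi_gt0.
- by apply: (le_trans _ (grho_ge_half (min_ge0 t0) (min_r2 t))); rewrite invr_ge0.
- by apply: phi_noninc => //; exact: min_ge0.
- by apply: grho_noninc => //; exact: min_ge0.
Qed.

Lemma slope_le_phi s : 0 <= s -> slope s <= phi s.
Proof.
move=> s0; apply: (@le_trans _ _ (phi (Num.min s r2))).
  by rewrite ler_piMr ?(ltW (phi_gt0 _ _))// grho_le1// min_ge0.
have [//|/ltW r2s] := leP s r2.
by rewrite (phi_const gamma_ge0 gamma_int r1_bounded r12 r2s).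
Qed.

Lemma slope_far s : r2 <= s -> phi r2 / 2 <= slope s.
Proof.
move=> r2s; rewrite /slope min_r// ler_pM2l ?phi_gt0//.
by apply: grho_ge_half => //; exact/ltW/r2_gt0.
Qed.

Lemma frho_le r : 0 <= r -> frho eps r0 a r2 lalpha lpi gamma r <= a + Phi r.
Proof.
move=> r_ge0; apply: lerD; first by rewrite ler_piMr ?(ltW a0)// lern1 leq_b1.
apply: le_Rintegral => //.
- by apply: locally_integrable_slope => // s t; exact: slope_noninc.
- exact: locally_integrable_phi.
- by move=> s /=; rewrite in_itv/= => /andP[s0 _]; exact: slope_le_phi.
Qed.

(** The counterpart of a lower bound for [- f''] on [(r - eps, r)] when
[r0 < r <= r2].  The first term, due to the decrease of [phi], absorbs a positive
drift; the second, due to the decrease of [grho], is the surplus that produces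
the contraction. *)
Definition steepness r :=
  (2 * Num.max (ubeta r) 0 * slope r + 2 * c * (a + Phi r)) / lalpha r.

Lemma steepness_ge0 r : r0 < r -> 0 <= steepness r.
Proof.
move=> r0r; rewrite divr_ge0 ?(ltW (lalpha_gt0 r0r))//.
have s0 : 0 <= slope r by exact/ltW/slope_gt0/ltW/(lt_trans r00).
apply: addr_ge0; apply: mulr_ge0 => //.
- by rewrite mulr_ge0// le_max lexx orbT.
- by rewrite mulr_ge0// ltW// rate_gt0.
- exact/ltW/aPhi_gt0.
Qed.

Lemma gamma_lower s r : 0 <= s -> r0 < r -> s < r -> r < s + eps ->
  2 * Num.max (ubeta r) 0 / lalpha r <= gamma s.
Proof.
move=> s0 r0r sr rs; have [b0|b0] := lerP (ubeta r) 0.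
  by rewrite mulr0 mul0r gamma_ge0.
rewrite -lee_fin; apply: le_trans (gamma_sup s0).
by apply: ereal_sup_ubound; exists r => //; apply/IhatP.
Qed.

(** The slope is the product of [phi] and [grho], and each factor contributes one
term of the steepness.  Between [s] and [r] the point [r] lies in all the
forward windows, so both [gamma] and the weight are bounded below by their
values for [r]. *)
Lemma slope_steep r s : r0 < r -> r <= r2 -> 0 <= s -> r - eps < s -> s < r ->
  steepness r * (r - s) <= slope s - slope r.
Proof.
move=> r0r rr2 s0 rs sr; have r_ge0 := le_trans s0 (ltW sr).
rewrite /slope !min_l// ?(le_trans (ltW sr))//.
have al := lalpha_gt0 r0r.
have d1 : phi r * (2 * Num.max (ubeta r) 0 / lalpha r * (r - s)) <= phi s - phi r.
  apply: phi_drop => //; first exact: ltW.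
  by move=> u /andP[su ur]; apply: gamma_lower => //; lra.
have d2 : (phi s)^-1 * ((a + Phi r) / lalpha r) * (r - s) <= J r - J s.
  apply: primitive_ge => //; [exact: iw|exact: ltW|].
  move=> u /andP[su ur]; have u0 := le_trans s0 (ltW su).
  rewrite mulrC ler_pdivrMr ?phi_gt0//.
  apply: (@le_trans _ _ (phi u * weight eps r0 a lalpha gamma u)).
    by apply: weight_ge => //; lra.
  rewrite mulrC ler_wpM2l ?weight_ge0//; apply: phi_noninc => //; exact: ltW.
have -> : phi s * g s - phi r * g r = (phi s - phi r) * g r + phi s * (g s - g r) by ring.
have gr : 0 <= g r.
  by apply: (le_trans _ (grho_ge_half r_ge0 rr2)); rewrite invr_ge0.
have ps := phi_gt0 gamma s.
have e1 := ler_wpM2r gr d1.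
have e2 : phi s * (2 * c * ((phi s)^-1 * ((a + Phi r) / lalpha r) * (r - s)))
    <= phi s * (g s - g r).
  by rewrite grhoB !ler_pM2l ?mulr_gt0 ?rate_gt0.
apply: le_trans (lerD e1 e2).
rewrite /steepness /slope min_l// le_eqVlt; apply/orP; left; apply/eqP.
by field; rewrite !gt_eqF.
Qed.

Local Notation f := (frho eps r0 a r2 lalpha lpi gamma).

(** At short distances coalescence pays for everything: it has probability [q] and
reward [a], which by the choice of [a] covers twice the drift [b] and leaves
[r0 * q]; the rate is at most [q / 2] and the profile at most [a + r0]. *)
Lemma near_balance r b q : 0 < r -> r <= r0 -> r0 <= a ->
  inf [set lpi r | r in `]0, r0]] <= q -> 2 * b <= (a - r0) * q ->
  f r + slope r * b - a * q <= (1 - c) * f r.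
Proof.
move=> r_gt0 rr0 r0a piq bq.
have cq : 2 * c <= q by apply: le_trans piq; exact: rate_le_pi.
have c0 := rate_gt0.
have fr : f r <= a + r0.
  apply: (le_trans (frho_le (ltW r_gt0))); rewrite lerD2l.
  by apply: le_trans rr0; apply: Phi_le => //; exact: ltW.
have sb : 2 * (slope r * b) <= (a - r0) * q.
  have s0 := slope_gt0 (ltW r_gt0).
  have s1 : slope r <= 1.
    by apply: (le_trans (slope_le_phi (ltW r_gt0))); exact: phi_le1.
  have [b0|b0] := lerP b 0.
    apply: (@le_trans _ _ 0); first by rewrite pmulr_rle0// pmulr_rle0.
    by rewrite mulr_ge0 ?subr_ge0//; lra.
  by apply: le_trans bq; rewrite ler_pM2l// ler_piMl// ltW.
have cf : 2 * (c * f r) <= q * (a + r0).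
  apply: (@le_trans _ _ (2 * c * (a + r0))); first by rewrite -mulrA !ler_pM2l.
  by rewrite ler_wpM2r// addr_ge0// ltW.
lra.
Qed.

(** At intermediate distances the two terms of the steepness, multiplied by half
of [lalpha], cancel the drift and yield [c * (a + Phi r)], which dominates
[c * f r]. *)
Lemma middle_balance r : r0 < r -> r <= r2 ->
  f r + slope r * ubeta r - steepness r / 2 * lalpha r <= (1 - c) * f r.
Proof.
move=> r0r rr2; have r_gt0 := lt_trans r00 r0r.
have al := lalpha_gt0 r0r.
have -> : steepness r / 2 * lalpha r = Num.max (ubeta r) 0 * slope r + c * (a + Phi r).
  by rewrite /steepness; field; rewrite gt_eqF.
have : slope r * ubeta r <= Num.max (ubeta r) 0 * slope r.
  by rewrite mulrC ler_wpM2r ?le_max ?lexx// ltW// slope_gt0// ltW.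
have : c * f r <= c * (a + Phi r).
  by rewrite ler_pM2l ?rate_gt0// frho_le// ltW.
lra.
Qed.

(** Beyond [r2] the profile is affine and the drift itself is negative enough. *)
Lemma far_balance r : r2 <= r -> f r + slope r * ubeta r <= (1 - c) * f r.
Proof.
move=> r2r; have r_ge0 : 0 <= r := le_trans (ltW r2_gt0) r2r.
have far := rate_far r2r.
have ub : ubeta r <= 0.
  have : 0 <= - (phi r2 / 2 * ubeta r).
    apply: le_trans far; rewrite mulr_ge0 ?(ltW rate_gt0)//; exact/ltW/aPhi_gt0.
  by rewrite oppr_ge0 pmulr_rle0// divr_gt0// phi_gt0.
have : slope r * ubeta r <= phi r2 / 2 * ubeta r.
  by rewrite ler_wnM2r// slope_far.
have : c * f r <= c * (a + Phi r) by rewrite ler_pM2l ?rate_gt0// frho_le.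
lra.
Qed.

End construction_facts.

(** * Integrating a pathwise drift bound *)

Section drift.
Context d (T : measurableType d) (R : realType).
Variable Q : {measure set T -> \bar R}.
Hypothesis Q1 : Q setT = 1%E.
Local Open Scope ereal_scope.

Let Qfin : Q setT < +oo. Proof. by rewrite Q1 ltry. Qed.

Lemma bounded_integrable (W : T -> R) (M : R) : measurable_fun setT W ->
  (forall w, `|W w| <= M)%R -> Q.-integrable setT (EFin \o W).
Proof.
move=> mW WM; apply: measurable_bounded_integrable => //.
exists M; split; rewrite ?num_real// => x Mx w _ /=.
exact: le_trans (WM w) (ltW Mx).
Qed.

(** A function bounded below on a probability space has a finite negative part, so
a finite upper bound on its integral bounds the positive part as well. *)
Lemma integrable_bounded_below (g : T -> R) (r u : R) : (0 <= r)%R ->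
  measurable_fun setT g -> (forall w, - r <= g w)%R ->
  \int[Q]_w (g w)%:E <= u%:E -> Q.-integrable setT (EFin \o g).
Proof.
move=> r0 mg gr gu; apply/integrableP; split; first exact/measurable_EFinP.
rewrite integral_fin_num_abs//; rewrite integralE in gu *.
have neg : \int[Q]_w (EFin \o g)^\- w \is a fin_num.
  rewrite ge0_fin_numE; last by apply: integral_ge0.
  apply: (@le_lt_trans _ _ (\int[Q]_w (cst r%:E w))); last first.
    by rewrite integral_cst//= Q1 mule1 ltry.
  apply: ge0_le_integral => //.
  - by apply: measurable_funeneg; exact/measurable_EFinP.
  - move=> w _; rewrite funenegE ge_max; apply/andP; split; last by rewrite lee_fin.
    by rewrite /= lee_fin lerNl.
rewrite fin_numB neg andbT ge0_fin_numE; last by apply: integral_ge0.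
rewrite ltey; apply/eqP => pos; move: gu; rewrite pos.
by move: neg; case: integral.
Qed.

(** A pathwise tangent bound with a bounded gain [W] passes to expectations. *)
Lemma drift_integral_le (Y g W : T -> R) (r u w0 C A B M : R) : (0 <= r)%R ->
  measurable_fun setT g -> measurable_fun setT W ->
  (forall w, - r <= g w)%R -> (forall w, `|W w| <= M)%R ->
  (0 <= A)%R -> (0 <= B)%R ->
  (forall w, 0 <= Y w)%R -> (forall w, Y w <= C + A * g w - B * W w)%R ->
  \int[Q]_w (g w)%:E <= u%:E -> w0%:E <= \int[Q]_w (W w)%:E ->
  \int[Q]_w (Y w)%:E <= (C + A * u - B * w0)%:E.
Proof.
move=> r0 mg mW gr WM A0 B0 Y0 YC gu wW.
have ig := integrable_bounded_below r0 mg gr gu.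
have iW := bounded_integrable mW WM.
have iC : Q.-integrable setT (EFin \o (cst C)).
  by apply: (@bounded_integrable _ `|C|%R).
have iAg : Q.-integrable setT (EFin \o (fun w => A * g w)%R).
  by apply: (integrableZl _ _ ig).
have iBW : Q.-integrable setT (EFin \o (fun w => B * W w)%R).
  by apply: (integrableZl _ _ iW).
have iCA : Q.-integrable setT (EFin \o (fun w => C + A * g w)%R).
  by apply: (integrableD _ iC iAg).
have mR : measurable_fun setT (fun w => C + A * g w - B * W w)%R.
  apply: measurable_funB; last exact: measurable_funM.
  by apply: measurable_funD => //; exact: measurable_funM.
apply: (@le_trans _ _ (\int[Q]_w (C + A * g w - B * W w)%:E)).
  apply: ae_ge0_le_lower_integral => //.
  - by move=> w _; rewrite lee_fin.
  - by move=> w _; rewrite lee_fin (le_trans (Y0 w)).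
  - exact/measurable_EFinP.
  - by apply: aeW => w _; rewrite lee_fin.
have -> : \int[Q]_w (C + A * g w - B * W w)%:E =
    (\int[Q]_w (C + A * g w - B * W w))%:E.
  rewrite /Rintegral fineK//; apply: integrable_fin_num => //.
  exact: (integrableB _ iCA iBW).
rewrite RintegralB// RintegralD// !RintegralZl// Rintegral_cst// Q1 mulr1 lee_fin.
rewrite lerB ?lerD2l ?ler_wpM2l//.
- by rewrite -lee_fin /Rintegral fineK//; exact: integrable_fin_num.
- by rewrite -lee_fin /Rintegral fineK//; exact: integrable_fin_num.
Qed.

Lemma full_event_ae (A : set T) : measurable A -> Q A = 1 -> {ae Q, forall w, A w}.
Proof.
move=> mA QA; exists (~` A); split=> //; first exact: measurableC.
rewrite -setTD; have /= -> := @measureD _ _ _ Q setT A measurableT mA.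
  by rewrite setTI Q1 QA subee.
by rewrite Q1 ltry.
Qed.

End drift.

(** * Measurability of the distance between the coupled points *)

Section coupling_distance.
Context (R : realType) (S : pmetricType R).
Context (d : measure_display) (Omega : measurableType d).
Variables (X' Y' : {mfun Omega >-> borel S}).

Lemma open_mdist_ball (z : S) (t : R) : open [set y : S | mdist z y < t].
Proof.
rewrite openE => y /= zy; rewrite /interior; apply/nbhs_ballP.
exists (t - mdist z y); first by rewrite /= subr_gt0.
move=> x; rewrite ballEmdist/= => yx.
by apply: (le_lt_trans (metric_triangle z y x)); rewrite addrC -ltrBrDr.
Qed.

Lemma measurable_mdist_to (Z : {mfun Omega >-> borel S}) (z : S) :
  measurable_fun setT (fun w => mdist z (Z w : S)).
Proof.
apply: (measurability (@RGenInftyO.G R)) => [|/= _ [_] [t] -> <-].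
  exact: RGenInftyO.measurableE.
rewrite (_ : (fun w => _) @^-1` _ = Z @^-1` [set y : S | mdist z y < t]); last first.
  by apply/seteqP; split=> w /=; rewrite in_itv.
have := @measurable_funPT _ _ _ _ Z.
move=> /(_ measurableT [set y : S | mdist z y < t])/=.
by apply; apply: sub_sigma_algebra; exact: open_mdist_ball.
Qed.

Lemma separable_dense_sequence : separable S ->
  exists e : nat -> S, forall (x : S) (t : R), 0 < t -> exists n, mdist (e n) x < t.
Proof.
move=> [D [cD dD]]; have [e De] : exists e : nat -> S, D `<=` range e.
  have [f injf] : exists f : S -> nat, {in D &, injective f} by exact/countable_injP.
  exists ('pinv_(fun=> point) D f) => x Dx; exists (f x) => //.
  by rewrite pinvKV ?inE.
exists e => x t t0.
have [|y [/= xy /De[n _ ny]]] := dD _ _ (open_mdist_ball x t).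
  by exists x => /=; rewrite mdistxx.
by exists n; rewrite ny metric_sym.
Qed.

(** The measurability of [X'] and [Y'] one by one gives that of their distances to a
fixed point.  By separability these determine their mutual distance: it is the
infimum, over a dense sequence [e], of the sums of the distances to [e n]. *)
Lemma measurable_newdist : separable S -> measurable_fun setT (newdist X' Y').
Proof.
move=> /separable_dense_sequence[e eS].
apply: (measurability (@RGenInftyO.G R)) => [|/= _ [_] [t] -> <-].
  exact: RGenInftyO.measurableE.
pose s n (w : Omega) := mdist (e n) (X' w : S) + mdist (e n) (Y' w : S).
rewrite setTI (_ : _ @^-1` _ = \bigcup_n (s n @^-1` `]-oo, t[)); last first.
  apply/seteqP; split=> w /=.
    rewrite in_itv/= => wt; have t2 : 0 < (t - newdist X' Y' w) / 2.
      by rewrite divr_gt0// subr_gt0.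
    have [n nX] := eS (X' w) _ t2; exists n => //=; rewrite in_itv/= /s.
    have := metric_triangle (e n) (X' w : S) (Y' w).
    by move: nX; rewrite -/(newdist X' Y' w); lra.
  move=> [n _] /=; rewrite !in_itv/= /s; apply: le_lt_trans.
  by rewrite (metric_sym (e n) (X' w : S)); exact: metric_triangle.
apply: bigcupT_measurable => n; rewrite -[X in measurable X]setTI.
have : measurable_fun setT (s n) by apply: measurable_funD; exact: measurable_mdist_to.
by apply.
Qed.

Lemma newdist_ge0 w : 0 <= newdist X' Y' w.
Proof. exact: mdist_ge0. Qed.

End coupling_distance.

(** * The contraction *)

Theorem theorem2p2 (R : realType) (S : pmetricType R) (d : measure_display)
    (Omega : measurableType d) (p : R.-pker (borel S) ~> (borel S))
    (P : R.-pker (borel S * borel S)%type ~> Omega)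
    (X' Y' : {mfun Omega >-> borel S})
    (eps r0 a r2 : R) (ubeta lalpha lpi gamma : R -> R)
    (c := rate eps r0 a r2 lalpha lpi gamma)
    (f := frho eps r0 a r2 lalpha lpi gamma)
    (rho := fun x y : S => f (mdist x y))
    (hsep : separable S)
    (hcoupling : markovian_coupling P X' Y' p)
    (heps : 0 < eps)
    (hlalpha : forall r, 0 < r -> 0 <= lalpha r)
    (hlpi : forall r, 0 < r -> 0 <= lpi r)
    (hbounds : forall (r : R) (x y : S), 0 < r -> mdist x y = r ->
      [/\ (beta P X' Y' x y <= (ubeta r)%:E)%E,
          ((lalpha r)%:E <= alpha P X' Y' eps x y)%E &
          ((lpi r)%:E <= pi0 P X' Y' x y)%E])
    (hr0 : 0 < r0)
    (hA1pi : 0 < inf [set lpi r | r in `]0, r0]])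
    (hA1alpha : forall s, r0 < s -> 0 < inf [set lalpha r | r in `]r0, s[])
    (hA2 : forall s, 0 < s ->
      (ereal_sup [set (ubeta r)%:E | r in `]0%R, s[] < +oo)%E)
    (hA3 : (limf_esup (fun r : R => (r^-1 * ubeta r)%:E) (pinfty_nbhs R) < 0)%E)
    (hgamma_ge0 : forall s, 0 <= s -> 0 <= gamma s)
    (hgamma_int : forall s, 0 <= s ->
      (@lebesgue_measure R).-integrable `[0, s] (EFin \o gamma))
    (hgamma : forall s, 0 <= s ->
      (ereal_sup [set (gammabar ubeta lalpha r)%:E | r in Ihat eps r0 s]
         <= (gamma s)%:E)%E)
    (hr1 : has_ubound [set r | 0 < r /\ 0 < gamma r])
    (ha : 0 < a)
    (ha_ge : (r0%:E + 2%:E *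
        ereal_sup [set beta P X' Y' z.1 z.2 / pi0 P X' Y' z.1 z.2
                  | z in [set z : S * S | (mdist z.1 z.2 <= r0)%R]]
        <= a%:E)%E)
    (hr12 : r1 gamma < r2)
    (hr2 : r2_condition r0 a r2 ubeta lalpha gamma) :
  [/\ 0 < c,
      {in `[0, +oo[, forall r, 0 <= f r},
      {in `[0, +oo[ &, {homo f : r s / r < s}},
      concave_function `[0, +oo[ f &
      forall x y : S, (x = y -> pi0 P X' Y' x y = 1%E) ->
        (\int[P (x, y)]_w (rho (X' w) (Y' w))%:E
           <= ((1 - c) * rho x y)%:E)%E].
Proof.
have hP z : P z setT = 1%E by exact: prob_kernel.
have mR : measurable_fun setT (newdist X' Y') by exact: measurable_newdist.
have mZ : measurable [set w | newdist X' Y' w = 0].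
  by rewrite -[X in measurable X]setTI; exact: (mR measurableT [set 0] (measurable_set1 0)).
have mD x y : measurable_fun setT (deltaR X' Y' x y).
  by apply: measurable_funB.
have Dge x y w : - mdist x y <= deltaR X' Y' x y w.
  by rewrite /deltaR addrC lerDl newdist_ge0.
set F := slope eps r0 a r2 lalpha lpi gamma.
have F_gt0 s : 0 <= s -> 0 < F s.
  exact: (slope_gt0 heps hr0 ha hlalpha
    hA1pi hA1alpha hgamma_ge0 hgamma_int hr1 hr12 hr2).
have F_noninc s t : 0 <= s -> s <= t -> F t <= F s.
  exact: (slope_noninc heps hr0 ha hlalpha
    hA1pi hA1alpha hgamma_ge0 hgamma_int hr1 hr12 hr2).
have fE : f = jump_profile a F by [].
have f_ge0 r : 0 <= f r by rewrite fE; apply: jump_profile_ge0 => //; exact: ltW.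
split.
- exact: (rate_gt0 heps hr0 ha hlalpha
  hA1pi hA1alpha hgamma_ge0 hgamma_int hr1 hr12 hr2).
- by move=> r _; exact: f_ge0.
- move=> r s; rewrite !in_itv/= !andbT => rp _ rs.
  by rewrite fE; apply: jump_profile_lt => //; exact: ltW.
- by rewrite fE; apply: jump_profile_concave => //; exact: ltW.
move=> x y diag; rewrite /rho.
(* On the diagonal the two points stay together almost surely. *)
have [xy|xy] := eqVneq x y.
  rewrite -xy mdistxx fE jump_profile0 mulr0 -fE.
  apply: (@le_trans _ _ (\int[P (x, x)]_w (cst 0 w))%E); last by rewrite integral0.
  apply: ae_ge0_le_lower_integral => //.
  - by move=> w _; rewrite lee_fin.
  - have := full_event_ae (hP _) mZ (diag xy); rewrite -xy.
    apply: filterS => w /= w0 _; rewrite -/(newdist X' Y' w) w0.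
    by rewrite fE jump_profile0.
have r_gt0 : 0 < mdist x y by rewrite mdist_gt0.
have [hb hal hpi] := hbounds _ x y r_gt0 erefl.
set r := mdist x y in r_gt0 hb hal hpi *.
set I := integral _ _ _.
have tangent w : f (newdist X' Y' w) <=
    f r + F r * deltaR X' Y' x y w - a * (newdist X' Y' w == 0)%:R.
  by rewrite fE; apply: jump_profile_tangent => //; exact: newdist_ge0.
(* The common shape of the three regimes: [W] is the indicator of coalescence, the
squared truncated decrease, or 0. *)
have drift u w0 B M (W : Omega -> R) : measurable_fun setT W ->
    (forall w, `|W w| <= M) -> 0 <= B ->
    (forall w, f (newdist X' Y' w) <= f r + F r * deltaR X' Y' x y w - B * W w) ->
    (beta P X' Y' x y <= u%:E)%E -> (w0%:E <= \int[P (x, y)]_w (W w)%:E)%E ->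
    f r + F r * u - B * w0 <= (1 - c) * f r -> (I <= ((1 - c) * f r)%:E)%E.
  move=> mW WM B0 fW bu wW fin; rewrite -lee_fin in fin; apply: le_trans fin.
  by apply: (@drift_integral_le _ _ _ _ (hP _) _ (deltaR X' Y' x y) W
      r u w0 (f r) (F r) B M) => //;
    [exact: ltW|exact: Dge|exact/ltW/F_gt0/ltW].
have [rr0|r0r] := lerP r r0.
- have bfin : beta P X' Y' x y \is a fin_num.
    apply: integrable_fin_num => //.
    exact: (integrable_bounded_below (hP _) (ltW r_gt0) (mD x y) (Dge x y) hb).
  have pfin : pi0 P X' Y' x y \is a fin_num.
    rewrite ge0_fin_numE ?measure_ge0//; apply: (@le_lt_trans _ _ (P (x, y) setT)).
      by apply: le_measure; rewrite ?inE.
    by rewrite hP ltry.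
  have [b bE] : exists b : R, beta P X' Y' x y = b%:E.
    by exists (fine (beta P X' Y' x y)); rewrite fineK.
  have [q pE] : exists q : R, pi0 P X' Y' x y = q%:E.
    by exists (fine (pi0 P X' Y' x y)); rewrite fineK.
  have lq : inf [set lpi s | s in `]0, r0]] <= q.
    move: hpi; rewrite pE lee_fin => lq; apply: le_trans lq; apply: ge_inf.
      exists 0 => _ [s /= sI <-]; move: sI; rewrite in_itv/= => /andP[s0 _].
      exact: hlpi.
    by exists r => //=; rewrite in_itv/= r_gt0.
  have q0 : 0 < q by exact: lt_le_trans lq.
  apply: (drift b q a 1 \1_[set w | newdist X' Y' w = 0]) => //.
  + by move=> w; rewrite indicE normr_nat lern1 leq_b1.
  + exact: ltW.
  + move=> w; apply: (le_trans (tangent w)); rewrite indicE.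
    rewrite (_ : (w \in _) = (newdist X' Y' w == 0))//.
    by apply/idP/eqP => [/set_mem//|w0]; exact/mem_set.
  + by rewrite bE.
  + by rewrite integral_indic// setIT -pE.
  + have sup_ge z : (mdist z.1 z.2 <= r0)%R ->
      (r0%:E + 2%:E * (beta P X' Y' z.1 z.2 / pi0 P X' Y' z.1 z.2) <= a%:E)%E.
      move=> zr0; apply: le_trans ha_ge; rewrite leeD2l// lee_pmul2l//.
      by apply: ereal_sup_ubound; exists z.
    (* The supremum is nonnegative because the drift on the diagonal is. *)
    have r0a : r0 <= a.
      rewrite -lee_fin; apply: le_trans (sup_ge (x, x) _); last by rewrite mdistxx ltW.
      rewrite leeDl// mule_ge0// mule_ge0//.
        apply: integral_ge0 => w _.
        by rewrite lee_fin (le_trans _ (Dge _ _ _))// mdistxx oppr0.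
      by rewrite inve_ge0 measure_ge0.
    apply: (near_balance heps hr0 ha hlalpha
      hA1pi hA1alpha hgamma_ge0 hgamma_int hr1 hr12 hr2) => //.
    have := sup_ge (x, y) rr0; rewrite /= bE pE inver gt_eqF// -!EFinM -EFinD lee_fin.
    by rewrite -lerBrDl mulrA ler_pdivrMr.
- have [rr2|r2r] := lerP r r2.
  + apply: (drift (ubeta r) (lalpha r) (steepness eps r0 a r2 ubeta lalpha lpi gamma r / 2)
      (eps ^+ 2) (fun w => `|Num.min (Num.max (- deltaR X' Y' x y w) 0) eps| ^+ 2)) => //.
    * apply: measurable_funX; apply: measurableT_comp => //.
      apply: measurable_minr => //; apply: measurable_maxr => //.
      exact: measurable_funN.
    * move=> w; rewrite normrX normr_id.
      have m0 : 0 <= Num.min (Num.max (- deltaR X' Y' x y w) 0) eps.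
        by rewrite le_min le_max lexx orbT ltW.
      rewrite ger0_norm//; apply: lerXn2r; rewrite ?nnegrE ?(ltW heps)//.
      by rewrite ge_min lexx orbT.
    * rewrite divr_ge0//.
      exact: (steepness_ge0 heps hr0 ha hlalpha
        hA1pi hA1alpha hgamma_ge0 hgamma_int hr1 hr12 hr2).
    * move=> w; rewrite fE real_normK ?num_real// /deltaR opprB.
      apply: jump_profile_steep => //; [exact: ltW| |exact: newdist_ge0|].
      - exact: (steepness_ge0 heps hr0 ha hlalpha
        hA1pi hA1alpha hgamma_ge0 hgamma_int hr1 hr12 hr2).
      - move=> s *.
        exact: (slope_steep heps hr0 ha hlalpha
          hA1pi hA1alpha hgamma_ge0 hgamma_int hgamma hr1 hr12 hr2).
    * exact: (middle_balance heps hr0 ha hlalpha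
      hA1pi hA1alpha hgamma_ge0 hgamma_int hr1 hr12 hr2).
  + apply: (drift (ubeta r) 0 0 0 (fun=> 0)) => //.
    * by move=> w; rewrite normr0.
    * move=> w; rewrite mul0r subr0; apply: (le_trans (tangent w)).
      by rewrite gerBl mulr_ge0// ltW.
    * by rewrite integral0.
    * rewrite mul0r subr0.
      exact: (far_balance heps hr0 ha hlalpha
        hA1pi hA1alpha hgamma_ge0 hgamma_int hr1 hr12 hr2 (ltW r2r)).
Qed.
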